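(* Let $k\ge 3$, put $m=\binom{k+1}{2}$, and suppose that $$n+1-k\ge 3\left(m^3+\binom m2\right).$$ If $\mathcal A\subseteq\mathcal F_k(M_n)$ is intersecting and $\operatorname{rk}\bigl(\bigwedge_{A\in\mathcal A}A\bigr)=0$, then $$|\mathcal A|\le \operatorname{HM}(n,k).$$ Equality holds if and only if $\mathcal A$ is isomorphic to $\mathcal G_k(a,Y)$. For $k=2$ the same conclusion holds for every $n\ge 3$ (that is, every intersecting $\mathcal A\subseteq\mathcal F_2(M_n)$ with $\operatorname{rk}(\bigwedge_{A\in\mathcal A}A)=0$ satisfies $|\mathcal A|\le\operatorname{HM}(n,2)$, with equality if and only if $\mathcal A$ is isomorphic to $\mathcal G_2(a,Y)$), and $\operatorname{HM}(n,2)=5$.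
   Context: Let $\Omega_n=\{0,1,\dots,n\}$ and let $M_n=M(K_{n+1})$ be the graphic matroid of the complete graph on vertex set $\Omega_n$. Its lattice of flats, ordered by inclusion, is identified with the lattice of set partitions of $\Omega_n$ ordered by refinement (finer $\le$ coarser): the partition $\pi$ corresponds to the flat that is the union of the edge sets of the complete graphs on the blocks of $\pi$, and this flat has rank $\operatorname{rk}=n+1-|\pi|$. Meet $\wedge$ is set intersection of flats (common refinement). Atoms are the rank-one flats (single edges). $\mathcal F_k(M_n)$ is the set of rank-$k$ flats, i.e. partitions of $\Omega_n$ into $n+1-k$ nonempty blocks. A nonempty family $\mathcal A\subseteq \mathcal F_k(M_n)$ is intersecting if $\operatorname{rk}(A\wedge B)\ge 1$ for all $A,B\in\mathcal A$; families called intersecting are always assumed nonempty. Two families $\mathcal A,\mathcal A'\subseteq\mathcal F_k(M_n)$ are isomorphic if there is a permutation $\sigma$ of $\Omega_n$ (acting naturally on flats) with $\sigma(\mathcal A)=\mathcal A'$. Construction: let $a$ be the atom corresponding to the edge $01$, let $Y\subseteq\Omega_n\setminus\{0,1\}$ be a $k$-set, and for $i\in\{0,1\}$ let $C_i$ be the rank-$k$ flat whose only nonsingleton block is $\{i\}\cup Y$. Define $$\mathcal G_k(a,Y):=\{F\in\mathcal F_k(M_n):a\le F\text{ and }\operatorname{rk}(F\wedge C_0)\ge 1\}\cup\{C_0,C_1\}.$$ (All choices of $Y$ give isomorphic families.) For $0\le y\le x$, $\genfrac{[}{]}{0pt}{}{x}{y}:=S(x+1,x+1-y)$, where $S(N,b)$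 is the Stirling number of the second kind. For integers $1\le r\le N$ and $1\le b\le N$, $\genfrac{[}{]}{0pt}{}{N-1}{N-b}_{r}^{\mathrm{sep}}$ denotes the number of partitions of an $N$-element set into $b$ blocks in which $r$ prescribed elements lie in distinct blocks. Finally $$\operatorname{HM}(n,k):=\genfrac{[}{]}{0pt}{}{n-1}{k-1}-\genfrac{[}{]}{0pt}{}{n-1}{k-1}_{k+1}^{\mathrm{sep}}+2.$$ *)

(* Defs.v *)
From mathcomp Require Import all_boot all_fingroup.

Set Implicit Arguments.
Unset Strict Implicit.
Unset Printing Implicit Defensive.

(* A flat of the graphic matroid M(K_(n+1)) is encoded as the set partition of
   the vertices 'I_n.+1 whose blocks carry the complete graphs making up the
   flat; [flat_edges] recovers the flat as a set of edges, meet being the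
   intersection of edge sets ([flat_edges_meet]). *)
Section Flats.
Variable n : nat.
Implicit Types (P Q : {set {set 'I_n.+1}}) (A : {set {set {set 'I_n.+1}}}).

Definition rk P : nat := n.+1 - #|P|.

Definition refines P Q : bool :=
  [forall B in P, [exists C in Q, B \subset C]].

Definition meet P Q : {set {set 'I_n.+1}} :=
  [set B :&: C | B in P, C in Q] :\ set0.

(* [set setT] is the one-block partition, i.e. the top flat. *)
Definition bigmeet A : {set {set 'I_n.+1}} :=
  \big[meet/[set [set: 'I_n.+1]]]_(P in A) P.

Definition flats (k : nat) : {set {set {set 'I_n.+1}}} :=
  [set P : {set {set 'I_n.+1}} | partition P [set: 'I_n.+1] & rk P == k].

Definition intersecting (k : nat) A : Prop :=
  [/\ A != set0, A \subset flats k &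
      forall P Q, P \in A -> Q \in A -> 1 <= rk (meet P Q)].

Definition perm_flat (s : {perm 'I_n.+1}) P : {set {set 'I_n.+1}} :=
  [set s @: (B : {set 'I_n.+1}) | B in P].

Definition isomorphic A A' : Prop :=
  exists s : {perm 'I_n.+1}, [set perm_flat s P | P in A] = A'.

(* Intended for nonempty S: the partition whose only (possibly) nonsingleton
   block is S. *)
Definition one_block (S : {set 'I_n.+1}) : {set {set 'I_n.+1}} :=
  S |: [set [set x] | x in ~: S].

(* For n >= 1 these are the two distinct vertices 0 and 1. *)
Definition v0 : 'I_n.+1 := ord0.
Definition v1 : 'I_n.+1 := inord 1.

Definition atom01 : {set {set 'I_n.+1}} := one_block [set v0; v1].

Definition HMfam (k : nat) (Y : {set 'I_n.+1}) : {set {set {set 'I_n.+1}}} :=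
  [set F in flats k | refines atom01 F && (1 <= rk (meet F (one_block (v0 |: Y))))]
    :|: [set one_block (v0 |: Y); one_block (v1 |: Y)].

Definition flat_edges P : {set {set 'I_n.+1}} :=
  [set e : {set 'I_n.+1} | #|e| == 2 & [exists B in P, e \subset B]].

Lemma meet_partition P Q :
  partition P [set: 'I_n.+1] -> partition Q [set: 'I_n.+1] ->
  partition (meet P Q) [set: 'I_n.+1].
Proof.
move=> /and3P[/eqP covP tiP _] /and3P[/eqP covQ tiQ _]; apply/and3P; split.
- rewrite eqEsubset subsetT; apply/subsetP => x _.
  have xP : x \in cover P by rewrite covP inE.
  have xQ : x \in cover Q by rewrite covQ inE.
  have xI : x \in pblock P x :&: pblock Q x by rewrite inE !mem_pblock xP xQ.
  apply/bigcupP; exists (pblock P x :&: pblock Q x) => //.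
  rewrite !inE; apply/andP; split; first by apply/set0Pn; exists x.
  by apply/imset2P; exists (pblock P x) (pblock Q x); rewrite ?pblock_mem.
- apply/trivIsetP => X Z /setD1P[_ /imset2P[B C BP CQ ->]].
  move=> /setD1P[_ /imset2P[D E DP EQ ->]] neq.
  rewrite -setI_eq0; apply/eqP/setP => x; rewrite !inE.
  apply/negP => /andP[/andP[xB xC] /andP[xD xE]]; case/negP: neq; apply/eqP.
  by rewrite -(def_pblock tiP BP xB) -(def_pblock tiQ CQ xC)
             -(def_pblock tiP DP xD) -(def_pblock tiQ EQ xE).
- by rewrite !inE eqxx.
Qed.

Lemma flat_edges_meet P Q :
  flat_edges (meet P Q) = flat_edges P :&: flat_edges Q.
Proof.
apply/setP => e; rewrite !inE; have [e2|//] := boolP (#|e| == 2).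
apply/existsP/andP => /=.
  case=> X /andP[/setD1P[_ /imset2P[B C BP CQ ->]]]; rewrite subsetI.
  by case/andP=> eB eC; split; apply/existsP;
     [exists B; rewrite BP | exists C; rewrite CQ].
case=> /existsP[B /andP[BP eB]] /existsP[C /andP[CQ eC]].
exists (B :&: C); rewrite subsetI eB eC !andbT !inE; apply/andP; split.
  apply: contraTneq e2 => BC0; suff -> : e = set0 by rewrite cards0.
  by apply/eqP; rewrite -subset0 -BC0 subsetI eB.
by apply/imset2P; exists B C.
Qed.

End Flats.

Definition stirling2 (N b : nat) : nat :=
  #|[set P : {set {set 'I_N}} | partition P [set: 'I_N] & #|P| == b]|.

(* The prescribed elements are the first r ones; this requires r <= N. *)
Definition stirling2_sep (r N b : nat) : nat :=
  #|[set P : {set {set 'I_N}} |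
      [&& partition P [set: 'I_N], #|P| == b &
          [forall i : 'I_N, forall j : 'I_N,
             [&& i < r, j < r & i != j] ==> (pblock P i != pblock P j)]]]|.

Definition brac (x y : nat) : nat := stirling2 x.+1 (x.+1 - y).

Definition brac_sep (r x y : nat) : nat := stirling2_sep r x.+1 (x.+1 - y).

(* The subtrahend counts a subset of what the minuend counts, so the truncated
   subtraction of nat is exact. *)
Definition HM (n k : nat) : nat :=
  brac n.-1 k.-1 - brac_sep k.+1 n.-1 k.-1 + 2.

(* Main.v *)
Require Import Defs.
From mathcomp Require Import all_boot all_fingroup.
From HB Require Import structures.
From mathcomp Require Import zify.

Set Implicit Arguments.
Unset Strict Implicit.
Unset Printing Implicit Defensive.

(* Let m = 'C(k+1, 2), the largest number of edges of a rank-k flat, b = n+1-k,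
   and s_j the number of rank-k flats above a given rank-j flat. For an edge e
   missed by some member of the family AA, each member through e contains one of
   the at most m rank-two flats spanned by e and an edge of that member.

   Call a rank-two flat W heavy if more than m * s_3 members of AA lie above it.
   A heavy flat meets every member of AA, heavy flats meet pairwise, and
   |AA| <= #heavy * s_2 + m^3 * s_3. Bonferroni gives HM >= m * s_2 + 2 - m^2 * s_3,
   so as s_2 >= b * s_3 and b is large, |AA| < HM when #heavy < m.

   If #heavy >= m >= 6, the rank-two case (where intersecting families without a
   common edge have at most 5 members) yields an edge e in all heavy flats. A
   member missing e then has at least m edges, so it is a clique on k+1 vertices,
   and its vertices outside e are determined by the heavy flats. Hence there are
   at most two such cliques, and all other members contain e and meet them.

   In rank two, either some edge lies in three members, and these play the role of
   the heavy flats, or every edge lies in at most two, and |AA| <= 1 + 3 because a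
   member has at most three edges. *)

(** * Set partitions *)

(* Locked, as unification would otherwise compare nested joins by unfolding them. *)
HB.lock Definition kerp (T rT : finType) (f : T -> rT) := preim_partition f [set: T].

(** All points whose block meets [e] get the value [set0], which is no block, so these blocks are
    merged. For an edge [e] this is the flat spanned by [W] and [e]. *)
HB.lock Definition join (T : finType) (W : {set {set T}}) (e : {set T}) :=
  kerp (fun z => if [disjoint pblock W z & e] then pblock W z else set0).

Section SetPartitions.
Variable T : finType.
Implicit Types (P Q W F : {set {set T}}) (e U B : {set T}) (x y z w : T).

Definition same P x y := pblock P x == pblock P y.

(** For a pair [U] this says that [U] is an edge of the flat [P]. *)
Definition contains P U := [exists B in P, U \subset B].

Definition finer W F := [forall x, forall y, same W x y ==> same F x y].

Definition edges P := [set e : {set T} | #|e| == 2 & contains P e].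

Definition draws U := [set e : {set T} | e \subset U & #|e| == 2].

Definition parts b := [set P : {set {set T}} | partition P [set: T] & #|P| == b].

Lemma card_edge_draws U : #|draws U| = 'C(#|U|, 2).
Proof. by rewrite -cards_draws; apply: eq_card => e; rewrite !inE. Qed.

Lemma finerP W F :
  reflect (forall x y, same W x y -> same F x y) (finer W F).
Proof.
apply: (iffP forallP) => [H x y Wxy | H x]; first exact: (implyP (forallP (H x) y)).
by apply/forallP => y; apply/implyP/H.
Qed.

Section OnePartition.
Variable P : {set {set T}}.
Hypothesis partP : partition P [set: T].

Lemma pblock_self x : x \in pblock P x.
Proof. by rewrite mem_pblock (cover_partition partP) inE. Qed.

Lemma pblockT_mem x : pblock P x \in P.
Proof. by rewrite pblock_mem // (cover_partition partP) inE. Qed.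

Lemma pblock_eq B x : B \in P -> x \in B -> pblock P x = B.
Proof. exact: def_pblock (partition_trivIset partP). Qed.

Lemma sameE x y : same P x y = (y \in pblock P x).
Proof.
by rewrite /same eq_pblock ?(partition_trivIset partP) // (cover_partition partP) inE.
Qed.

Lemma same_blockP x y :
  reflect (exists2 B, B \in P & x \in B /\ y \in B) (same P x y).
Proof.
apply: (iffP idP) => [sxy | [B BP [xB yB]]].
  by exists (pblock P x); rewrite ?pblockT_mem // pblock_self -sameE.
by rewrite /same (pblock_eq BP xB) (pblock_eq BP yB).
Qed.

Lemma imset_pblock : pblock P @: [set: T] = P.
Proof.
apply/setP => B; apply/imsetP/idP => [[x _ ->] | BP]; first exact: pblockT_mem.
have /set0Pn[x xB] := partition_neq0 partP BP.
by exists x; rewrite // (pblock_eq BP xB).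
Qed.

Lemma contains_same U x y : contains P U -> x \in U -> y \in U -> same P x y.
Proof.
case/existsP => B /andP[BP /subsetP UB] xU yU.
by apply/same_blockP; exists B; rewrite // !UB.
Qed.

Lemma contains2 x y : contains P [set x; y] = same P x y.
Proof.
apply/idP/idP => [cP | /same_blockP[B BP [xB yB]]].
  by apply: (contains_same cP); rewrite !inE eqxx ?orbT.
by apply/existsP; exists B; rewrite BP subUset !sub1set xB yB.
Qed.

Lemma card_partition_le : #|P| <= #|T|.
Proof. by rewrite -cardsT -imset_pblock leq_imset_card. Qed.

Lemma edges_neq0 : (edges P != set0) = (#|P| < #|T|).
Proof.
rewrite -cardsT -{2}imset_pblock; apply/set0Pn/idP => [[e] | ltP].
  rewrite inE => /andP[/cards2P[x [y [xy ->]]]]; rewrite contains2 => /eqP sxy.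
  rewrite ltn_neqAle leq_imset_card andbT; apply: contraNN xy => /imset_injP inj.
  by apply/eqP/inj; rewrite ?inE.
have /dinjectivePn[x _ [y /andP[/= yx _] sxy]] : ~~ dinjectiveb (pblock P) [set: T].
  apply: contraTN ltP => /dinjectiveP inj; rewrite -leqNgt card_in_imset //.
exists [set x; y]; rewrite inE contains2 /same sxy eqxx andbT cards2.
by rewrite (eq_sym x) yx.
Qed.

End OnePartition.

Lemma partition_eq P Q :
  partition P [set: T] -> partition Q [set: T] -> same P =2 same Q -> P = Q.
Proof.
move=> partP partQ eqPQ.
rewrite -(imset_pblock partP) -(imset_pblock partQ); apply: eq_imset => x.
by apply/setP => y; rewrite -!sameE // eqPQ.
Qed.

(** Sending a block of [W] to the block of [F] around it maps [W] onto [F], and this map is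
    injective exactly when the two partitions agree. *)
Lemma finer_card W F :
  partition W [set: T] -> partition F [set: T] -> finer W F -> #|F| <= #|W| ?= iff (W == F).
Proof.
move=> partW partF /finerP WF; pose h B := if [pick x in B] is Some x then pblock F x else set0.
have hW x : h (pblock W x) = pblock F x.
  rewrite /h; case: pickP => [y | /(_ x)]; last by rewrite pblock_self.
  by rewrite -sameE // => /WF /eqP.
have defF : F = h @: W.
  rewrite -{1}(imset_pblock partF) -{1}(imset_pblock partW) -imset_comp.
  by apply: eq_imset => x; rewrite /= hW.
split; first by rewrite defF leq_imset_card.
rewrite {1}defF; apply/imset_injP/eqP => [inj | WFeq B C].
  apply: partition_eq => // x y; apply/idP/idP; first exact: WF.
  by rewrite /same -!hW => /eqP/inj -> //; apply: pblockT_mem.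
rewrite -{1 2}(imset_pblock partW) => /imsetP[x _ ->] /imsetP[y _ ->].
by rewrite !hW WFeq.
Qed.

Lemma finer_eq W F :
  partition W [set: T] -> partition F [set: T] -> finer W F -> #|W| = #|F| -> W = F.
Proof.
move=> partW partF /(finer_card partW partF) [_] eqWF cWF; apply/eqP.
by rewrite -eqWF cWF.
Qed.

Section Kernel.
Variables (rT : finType) (f : T -> rT).

Lemma kerp_partition : partition (kerp f) [set: T].
Proof. by rewrite kerp.unlock; apply: preim_partitionP. Qed.

Lemma same_kerp x y : same (kerp f) x y = (f x == f y).
Proof.
rewrite (sameE kerp_partition) kerp.unlock pblock_equivalence_partition ?inE //.
by move=> u v w _ _ _ /=; split=> // /eqP ->.
Qed.

Lemma card_kerp : #|kerp f| = #|f @: [set: T]|.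
Proof.
have -> : kerp f = (fun v => f @^-1: [set v]) @: (f @: [set: T]).
  rewrite kerp.unlock -imset_comp; apply: eq_imset => x.
  by apply/setP => y; rewrite !inE eq_sym.
rewrite card_in_imset // => _ _ /imsetP[x _ ->] /imsetP[y _ ->] /setP/(_ x).
by rewrite !inE eqxx => /esym/eqP.
Qed.

End Kernel.

Definition discrete := kerp (@id T).

Lemma discrete_partition : partition discrete [set: T].
Proof. exact: kerp_partition. Qed.

Lemma same_discrete x y : same discrete x y = (x == y).
Proof. exact: same_kerp. Qed.

Lemma card_discrete : #|discrete| = #|T|.
Proof. by rewrite card_kerp imset_id cardsT. Qed.

Lemma finer_discrete F : finer discrete F.
Proof. by apply/finerP => x y; rewrite same_discrete => /eqP ->; apply: eqxx. Qed.

Lemma discrete_edge e : #|e| = 2 -> ~~ contains discrete e.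
Proof.
move=> /eqP/cards2P[x [y [xy ->]]].
by rewrite (contains2 discrete_partition) same_discrete.
Qed.

Lemma join_partition W e : partition (join W e) [set: T].
Proof. by rewrite join.unlock; apply: kerp_partition. Qed.

Lemma join_disjoint W e z w :
  partition W [set: T] -> [disjoint pblock W z & e] -> same (join W e) z w -> same W z w.
Proof.
move=> partW dz; rewrite join.unlock same_kerp dz; case: ifP => // _ /eqP z0.
by have := pblock_self partW z; rewrite z0 inE.
Qed.

Lemma disjoint_set2 B x y : [disjoint B & [set x; y]] = (x \notin B) && (y \notin B).
Proof. by rewrite disjoint_sym disjoints_subset subUset !sub1set !inE. Qed.

(** The join only identifies points whose [W]-blocks meet [e], and any coarsening of [W] containing
    [e] does so too. Imposing one more edge thus amounts to lying above one larger flat. *)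
Lemma finer_join W e F :
  partition W [set: T] -> partition F [set: T] -> #|e| = 2 ->
  finer (join W e) F = finer W F && contains F e.
Proof.
move=> partW partF /eqP/cards2P[x [y [xy ->]]]; rewrite contains2 // join.unlock.
have disj z : [disjoint pblock W z & [set x; y]] = ~~ (same W z x || same W z y).
  by rewrite disjoint_set2 !sameE // negb_or.
apply/finerP/andP => [H | [/finerP WF Fxy] z w].
  split; last by apply: H; rewrite same_kerp !disj /same !eqxx ?orbT.
  apply/finerP => z w Wzw; apply: H; rewrite same_kerp !disj /same.
  by rewrite (eqP Wzw).
have Fz u : same W u x || same W u y -> same F u x.
  by case/orP=> /WF // /eqP Fuy; rewrite /same Fuy (eqP Fxy).
rewrite same_kerp !disj; case: ifPn => [nz|/negPn Wz]; case: ifPn => [nw|/negPn Ww].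
- exact: WF.
- by move/eqP=> z0; have := pblock_self partW z; rewrite z0 inE.
- by move/eqP=> z0; have := pblock_self partW w; rewrite -z0 inE.
- by move=> _; rewrite /same (eqP (Fz _ Wz)) (eqP (Fz _ Ww)).
Qed.

(** The blocks of the two ends of [e] leave the image and the single value [set0] enters, so the
    rank grows by one. *)
Lemma card_join W e :
  partition W [set: T] -> #|e| = 2 -> ~~ contains W e -> #|join W e| = #|W|.-1.
Proof.
move=> partW /eqP/cards2P[x [y [xy ->]]]; rewrite contains2 // => nxy.
rewrite join.unlock card_kerp; set f := (fun z => _).
have -> : f @: [set: T] = set0 |: (W :\ pblock W x :\ pblock W y).
  apply/setP => B; apply/imsetP/setU1P => [[z _ ->] | ]; rewrite /f.
    case: ifPn => [|_]; last by left.
    rewrite disjoint_set2 -!sameE // => /andP[nx ny]; right.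
    by rewrite !inE pblockT_mem // andbT; apply/andP; split.
  case=> [-> | ].
    by exists x; rewrite // disjoint_set2 pblock_self.
  rewrite !inE => /and3P[By Bx BW].
  have /set0Pn[z zB] := partition_neq0 partW BW.
  have Bz := pblock_eq partW BW zB.
  exists z; rewrite // disjoint_set2 -!sameE //.
  by rewrite /same Bz Bx By.
rewrite cardsU1 !inE (partition0 partW) !andbF.
have := cardsD1 (pblock W x) W; have := cardsD1 (pblock W y) (W :\ pblock W x).
rewrite !inE !pblockT_mem // andbT (eq_sym (pblock W y)) -/(same W x y) (negPf nxy).
by move=> /= e1 ->; rewrite e1.
Qed.

End SetPartitions.

(** * Counting the partitions coarser than a given one *)

Section Pullback.
Variables (T T' : finType) (q : T -> T').
Hypothesis q_surj : forall i, exists z, q z = i.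

Definition pull (P : {set {set T'}}) := kerp (fun z => pblock P (q z)).

Lemma same_pull P z w : same (pull P) z w = same P (q z) (q w).
Proof. exact: same_kerp. Qed.

Lemma card_pull P : partition P [set: T'] -> #|pull P| = #|P|.
Proof.
move=> partP; rewrite card_kerp imset_comp.
have -> : q @: [set: T] = [set: T'].
  apply/setP => i; rewrite inE; apply/imsetP.
  by have [z <-] := q_surj i; exists z.
by rewrite imset_pblock.
Qed.

(** [pull] is a bijection from the partitions of [T'] to the partitions of [T] coarser than the
    kernel of [q], and it keeps the number of blocks. The predicate [phi] carries side conditions
    along. *)
Lemma card_pull_set b (phi : pred {set {set T}}) :
  #|[set F in parts T b | (finer (kerp q) F) && phi F]| =
  #|[set P in parts T' b | phi (pull P)]|.
Proof.
rewrite -(card_in_imset (f := pull) (D := [set P in parts T' b | phi (pull P)])); last first.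
  move=> P Q; rewrite !inE => /andP[/andP[pP _] _] /andP[/andP[pQ _] _] eqPQ.
  apply: partition_eq => // i j; have [z <-] := q_surj i; have [w <-] := q_surj j.
  by rewrite -!same_pull eqPQ.
apply: eq_card => F; apply/idP/imsetP => [|[P]]; rewrite !inE.
  case/and3P=> /andP[partF cF] /finerP kF phiF.
  have kFq z w : q z = q w -> same F z w by move=> zw; apply: kF; rewrite same_kerp zw.
  have q_eq i : exists z, q z == i by have [z <-] := q_surj i; exists z.
  (* A section [r] of [q] brings [F] down to [T']. *)
  pose r i := xchoose (q_eq i); have rK i : q (r i) = i := eqP (xchooseP (q_eq i)).
  pose P := kerp (fun i => pblock F (r i)).
  have FP : F = pull P.
    apply: partition_eq => //; first exact: kerp_partition.
    move=> z w; rewrite same_pull same_kerp /same.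
    by rewrite (eqP (kFq (r (q z)) z _)) ?rK // (eqP (kFq (r (q w)) w _)) ?rK.
  have partP : partition P [set: T'] by apply: kerp_partition.
  by exists P; rewrite // !inE partP -FP phiF -card_pull // -FP cF.
case/andP=> /andP[partP cP] phiP ->.
rewrite phiP kerp_partition card_pull // cP !andbT /=.
by apply/finerP => z w; rewrite same_kerp same_pull => /eqP ->; apply: eqxx.
Qed.

End Pullback.

Lemma finer_kerp (T rT : finType) (q : T -> rT) (W F : {set {set T}}) :
  (forall z w, (q z == q w) = same W z w) -> finer (kerp q) F = finer W F.
Proof.
by move=> qW; apply: eq_forallb => z; apply: eq_forallb => w; rewrite same_kerp qW.
Qed.

Section Above.
Variable T : finType.
Implicit Types (W F : {set {set T}}).

Definition above b W := [set F in parts T b | finer W F].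

Lemma aboveP b W F : reflect (F \in parts T b /\ finer W F) (F \in above b W).
Proof. exact: setIdP. Qed.

Lemma parts_partition b F : F \in parts T b -> partition F [set: T].
Proof. by rewrite inE => /andP[]. Qed.

(** Contracting each block of [W] to a point, labelled by its index in [enum W], turns the
    partitions above [W] into partitions of [#|W|] points. *)
Lemma card_above b W :
  partition W [set: T] -> #|above b W| = stirling2 #|W| b.
Proof.
move=> partW.
have Wz z : pblock W z \in enum W by rewrite mem_enum pblockT_mem.
have lt_idx z : index (pblock W z) (enum W) < #|W| by rewrite cardE index_mem.
pose q z := Ordinal (lt_idx z).
have qE z w : (q z == q w) = same W z w.
  rewrite -val_eqE /=; apply/eqP/eqP => [|-> //].
  by move/(index_inj set0); apply; apply: Wz.
have q_surj i : exists z, q z = i.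
  have iW : nth set0 (enum W) i \in W by rewrite -mem_enum mem_nth // -cardE.
  have /set0Pn[z zi] := partition_neq0 partW iW.
  exists z; apply: val_inj; rewrite /= (pblock_eq partW iW zi) index_uniq ?enum_uniq //.
  by rewrite -cardE.
rewrite /stirling2 -[RHS](eq_card (A := [set P in parts 'I_#|W| b | predT (pull q P)])).
  rewrite -card_pull_set //; apply: eq_card => F.
  by rewrite !inE (finer_kerp _ qE) andbT.
by move=> P; rewrite !inE andbT.
Qed.

End Above.

(** Half of the Stirling recurrence: the new point [ord_max] may join any of the [b] blocks of a
    partition of the old points, with distinct results. *)
Lemma stirling2_grow r b : b * stirling2 r b <= stirling2 r.+1 b.
Proof.
pose g (u : 'I_b * {set {set 'I_r}}) (z : 'I_r.+1) :=
  if unlift ord_max z is Some z' then pblock u.2 z' else nth set0 (enum u.2) u.1.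
pose h u := kerp (g u).
have -> : b * stirling2 r b = #|h @: (setX [set: 'I_b] (parts 'I_r b))|.
  rewrite card_in_imset ?cardsX ?cardsT ?card_ord // => -[i P] [j Q].
  rewrite !inE /= => /andP[pP /eqP cP] /andP[pQ /eqP cQ] huv.
  have eqPQ : P = Q.
    apply: partition_eq => // x y; have := same_kerp (g (i, P)) (lift ord_max x) (lift ord_max y).
    by rewrite -/(h _) huv same_kerp /g !liftK.
  subst Q.
  (* The index [i] is recovered from an old point of the chosen block, which shares its block with
     [ord_max]. *)
  have PI (l : 'I_b) : nth set0 (enum P) l \in P by rewrite -mem_enum mem_nth // -cardE cP.
  have /set0Pn[z zi] := partition_neq0 pP (PI i).
  have := same_kerp (g (i, P)) ord_max (lift ord_max z).
  rewrite -/(h _) huv same_kerp /g !liftK unlift_none /= (pblock_eq pP (PI i) zi) eqxx.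
  rewrite nth_uniq ?enum_uniq -?cardE ?cP // => /eqP/val_inj ->; congr pair.
apply: subset_leq_card; apply/subsetP => _ /imsetP[[i P] + ->]; rewrite !inE /=.
case/andP=> pP /eqP cP; rewrite kerp_partition card_kerp /= -[X in _ == X]cP.
apply/eqP/eq_card => B.
have PI : nth set0 (enum P) i \in P by rewrite -mem_enum mem_nth // -cardE cP.
apply/imsetP/idP => [[z _ ->] | BP].
  by rewrite /g /=; case: unliftP => [w _|_] //; apply: pblockT_mem.
have /set0Pn[z zB] := partition_neq0 pP BP.
by exists (lift ord_max z); rewrite ?inE // /g liftK (pblock_eq pP BP zB).
Qed.

(** * Counting *)

#[local] Hint Resolve kerp_partition discrete_partition join_partition : core.

Lemma card_bigcup_le (I X : finType) (J : {set I}) (F : I -> {set X}) c :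
  (forall i, i \in J -> #|F i| <= c) -> #|\bigcup_(i in J) F i| <= #|J| * c.
Proof.
move=> leF; rewrite -sum_nat_const; elim/big_rec2: _ => [|i a B iJ leB].
  by rewrite cards0.
by rewrite (leq_trans (leq_card_setU _ _)) // leq_add // leF.
Qed.

(** Indices are removed one at a time: [F i] shares at most [t] points with each remaining set. The
    square generously bounds the number of pairs. *)
Lemma bonferroni (I X : finType) (J : {set I}) (F : I -> {set X}) s t :
  (forall i, i \in J -> s <= #|F i|) ->
  (forall i j, i \in J -> j \in J -> i != j -> #|F i :&: F j| <= t) ->
  #|J| * s <= #|\bigcup_(i in J) F i| + #|J| ^ 2 * t.
Proof.
move: {2}#|J| (leqnn #|J|) => c; elim: c J => [|c IH] J leJ les let_.
  by move: leJ; rewrite leqn0 => /eqP ->.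
have [->|/set0Pn[i iJ]] := eqVneq J set0; first by rewrite cards0.
have cJ := cardsD1 i J; rewrite iJ in cJ.
have subJ j : j \in J :\ i -> j \in J by case/setD1P.
have {IH} IH : #|J :\ i| * s <= #|\bigcup_(j in J :\ i) F j| + #|J :\ i| ^ 2 * t.
  apply: IH => [|j /subJ|j l /subJ jJ /subJ lJ]; [lia | exact: les | exact: let_].
rewrite (big_setD1 i iJ) /=.
have := cardsUI (F i) (\bigcup_(j in J :\ i) F j).
rewrite big_distrr /=.
have : #|\bigcup_(j in J :\ i) (F i :&: F j)| <= #|J :\ i| * t.
  by apply: card_bigcup_le => j /setD1P[ji jJ]; apply: let_; rewrite // eq_sym.
have := les i iJ; rewrite cJ /= add1n.
move: #|_ :|: _| #|J :\ i| IH => u d; rewrite -!mulnn; lia.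
Qed.

Lemma double_bin2 a : 2 * 'C(a, 2) = a * a.-1.
Proof. by rewrite -mul_bin_diag bin1. Qed.

(** * The number of edges of a flat of given rank *)

Section EdgeCount.
Variables (T : finType) (P : {set {set T}}) (c : nat).
Hypotheses (partP : partition P [set: T]) (rkP : #|T| - #|P| = c).

Let block_gt0 B : B \in P -> 0 < #|B|.
Proof. by move=> BP; rewrite card_gt0 (partition_neq0 partP). Qed.

Lemma sum_block_pred : \sum_(B in P) #|B|.-1 = c.
Proof.
rewrite -rkP -cardsT (card_partition partP).
have -> : \sum_(A in P) #|A| = \sum_(A in P) #|A|.-1 + #|P|.
  by rewrite -sum1_card -big_split; apply: eq_bigr => B /block_gt0; rewrite /= addn1 => /prednK.
by rewrite addnK.
Qed.

Lemma card_edges_sum : 2 * #|edges P| <= \sum_(B in P) #|B| * #|B|.-1.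
Proof.
have sub : edges P \subset \bigcup_(B in P) draws B.
  apply/subsetP => e; rewrite inE => /andP[ce /existsP[B /andP[BP eB]]].
  by apply/bigcupP; exists B; rewrite // inE eB.
rewrite (eq_bigr (fun B : {set T} => 2 * #|draws B|)); last first.
  by move=> B _; rewrite card_edge_draws double_bin2.
rewrite -big_distrr leq_mul2l /= (leq_trans (subset_leq_card sub)) //.
elim/big_rec2: _ => [|B a S _ leS]; first by rewrite cards0.
by rewrite (leq_trans (leq_card_setU _ _)) // leq_add2l.
Qed.

Lemma block_pred_le B : B \in P -> #|B|.-1 <= c.
Proof. by move=> BP; rewrite -sum_block_pred (bigD1 B) //= leq_addr. Qed.

(** Every block has at most [c.+1] points, and the numbers [#|B|.-1] add up to [c]. *)
Lemma card_edges_le : #|edges P| <= 'C(c.+1, 2).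
Proof.
rewrite -(leq_pmul2l (ltn0Sn 1)) double_bin2 (leq_trans card_edges_sum) //=.
rewrite -{2}sum_block_pred big_distrr /= leq_sum // => B BP.
rewrite leq_mul2r; have := block_pred_le BP; lia.
Qed.

(** Equality case of [card_edges_le]: a block with [c.+1] points uses up the whole rank and leaves
    only singletons. *)
Lemma card_edges_max :
  0 < c -> 'C(c.+1, 2) <= #|edges P| ->
  exists2 U : {set T}, #|U| = c.+1 &
    forall x y, same P x y = (x == y) || (x \in U) && (y \in U).
Proof.
move=> c0 maxP.
have [/existsP[U /andP[UP /eqP cU]]|/existsPn noU] :=
  boolP [exists U, (U \in P) && (#|U| == c.+1)].
  exists U => // x y; apply/idP/idP => [/(same_blockP partP)[B BP [xB yB]]|].
    have [BU|BU] := eqVneq B U; first by rewrite -BU xB yB orbT.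
    have : #|B|.-1 = 0.
      have := sum_block_pred; rewrite (bigD1 U) //= cU (bigD1 B) ?BP //=; lia.
    move=> B0; have /eqP/cards1P[z Bz] : #|B| = 1 by have := block_gt0 BP; lia.
    by move: xB yB; rewrite Bz !inE => /eqP -> /eqP ->; rewrite eqxx.
  case/orP=> [/eqP -> | /andP[xU yU]]; first exact: eqxx.
  by apply/(same_blockP partP); exists U.
(* With all blocks of at most [c] points the doubled edge count stays below the required
   [c.+1 * c]. *)
have : \sum_(B in P) #|B| * #|B|.-1 <= c * c.
  rewrite -{2}sum_block_pred big_distrr /= leq_sum // => B BP.
  rewrite leq_mul2r; have := block_pred_le BP.
  have := noU B; rewrite BP /=; lia.
move/(leq_trans card_edges_sum); move: maxP.
rewrite -(leq_pmul2l (ltn0Sn 1)) double_bin2 /=; nia.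
Qed.

End EdgeCount.

(** Both lists are completed to enumerations of [T], whose entries are then matched position by
    position. *)
Lemma perm_of_seqs (T : finType) (s t : seq T) :
  uniq s -> uniq t -> size s = size t -> exists p : {perm T}, map p s = t.
Proof.
pose full (u : seq T) := u ++ [seq x <- enum T | x \notin u].
have full_uniq u : uniq u -> uniq (full u).
  move=> uu; rewrite cat_uniq uu filter_uniq ?enum_uniq // andbT /=.
  by apply/hasPn => x; rewrite mem_filter => /andP[].
have full_mem u x : x \in full u.
  by rewrite mem_cat mem_filter mem_enum andbT; case: (x \in u).
have full_size u : uniq u -> size (full u) = #|T|.
  move=> uu; rewrite -(card_uniqP (full_uniq u uu)); apply: eq_card => x.
  by rewrite full_mem.
move=> us ut st; pose f x := nth x (full t) (index x (full s)).
have lt_idx x : index x (full s) < size (full t).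
  by rewrite full_size // -(full_size s us) index_mem full_mem.
have f_inj : injective f.
  move=> x y; rewrite /f (set_nth_default y) // => /eqP.
  rewrite nth_uniq ?full_uniq // => /eqP/(congr1 (nth x (full s))).
  by rewrite !nth_index.
exists (perm f_inj); have [s0|s0] := posnP (size s).
  by rewrite (size0nil s0); apply/esym/size0nil; rewrite -st.
have x0 : T by case: (s) s0.
apply: (@eq_from_nth _ x0) => [|i]; rewrite size_map //; move=> lti.
rewrite (nth_map x0) // permE /f index_cat mem_nth // index_uniq //.
by rewrite nth_cat -st lti; apply: set_nth_default; rewrite -st.
Qed.

Lemma perm_of_sets (T : finType) (A B : {set T}) :
  #|A| = #|B| -> exists p : {perm T}, p @: A = B.
Proof.
move=> AB; have szAB : size (enum A) = size (enum B) by rewrite -!cardE.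
have [p pAB] := perm_of_seqs (enum_uniq A) (enum_uniq B) szAB.
exists p; apply/setP => y; rewrite -[RHS]mem_enum -pAB.
apply/imsetP/mapP => -[x xA ->]; exists x => //; first by rewrite mem_enum.
by rewrite -mem_enum.
Qed.

(** * Flats sharing an edge with a clique *)

Section Linked.
Variable T : finType.
Implicit Types (P F : {set {set T}}) (e f U : {set T}).

(** On the prescribed points this is the negation of the separation condition in [stirling2_sep]. *)
Definition linked P U := [exists e in draws U, contains P e].

Lemma drawsP e U :
  reflect (exists x y, [/\ x != y, x \in U, y \in U & e = [set x; y]]) (e \in draws U).
Proof.
rewrite inE; apply: (iffP andP) => [[eU /cards2P[x [y [xy exy]]]]|].
  by exists x, y; move: eU; rewrite exy subUset !sub1set => /andP[-> ->].
by case=> x [y [xy xU yU ->]]; rewrite subUset !sub1set xU yU cards2 xy.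
Qed.

Lemma linkedP P U :
  partition P [set: T] ->
  reflect (exists x y, [/\ x != y, x \in U, y \in U & same P x y]) (linked P U).
Proof.
move=> partP; apply: (iffP existsP) => [[e /andP[/drawsP[x [y [xy xU yU ->]]]]]|].
  by rewrite contains2 // => sxy; exists x, y.
case=> x [y [xy xU yU sxy]]; exists [set x; y]; rewrite contains2 // sxy andbT.
by apply/drawsP; exists x, y.
Qed.

Lemma singleton_discrete x : pblock (discrete T) x = [set x].
Proof.
by apply/setP => y; rewrite -(sameE (discrete_partition T)) same_discrete inE eq_sym.
Qed.

Lemma edge_of_join e f :
  #|e| = 2 -> #|f| = 2 -> contains (join (discrete T) e) f -> f = e.
Proof.
move=> ce /eqP/cards2P[x [y [xy ->]]].
rewrite (contains2 (join_partition _ _)) => sxy.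
have mem_e u v : u != v -> same (join (discrete T) e) u v -> u \in e.
  move=> uv suv; apply: contraNT uv => ue.
  rewrite -same_discrete; apply: (join_disjoint (discrete_partition T) _ suv).
  by rewrite singleton_discrete disjoints1.
apply/eqP; rewrite eqEcard subUset !sub1set cards2 xy ce (mem_e x y) //=.
by rewrite (mem_e y x) // 1?eq_sym // /same eq_sym.
Qed.

(** Splitting by the common edge prepares both the union bound and the Bonferroni bound below. *)
Lemma linked_bigcup b U :
  [set P in parts T b | linked P U] = \bigcup_(f in draws U) above b (join (discrete T) f).
Proof.
apply/setP => P; apply/setIdP/bigcupP => [[PP /existsP[f /andP[fU Pf]]]|[f fU /aboveP[PP]]].
  have /setIdP[_ /eqP cf] := fU; have partP := parts_partition PP.
  exists f => //; apply/aboveP; split=> //.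
  by rewrite finer_join // finer_discrete Pf.
have /setIdP[_ /eqP cf] := fU; have partP := parts_partition PP.
rewrite finer_join // finer_discrete => Pf; split=> //.
by apply/existsP; exists f; rewrite fU.
Qed.

Lemma card_above_edge b f :
  #|f| = 2 -> #|above b (join (discrete T) f)| = stirling2 #|T|.-1 b.
Proof.
move=> cf; rewrite card_above; last exact: join_partition.
by rewrite card_join ?discrete_edge ?card_discrete //; apply: discrete_partition.
Qed.

Lemma card_above_edges b f (g : {set T}) :
  #|f| = 2 -> #|g| = 2 -> f != g ->
  #|above b (join (join (discrete T) f) g)| = stirling2 #|T|.-2 b.
Proof.
move=> cf cg fg; have nfg : ~~ contains (join (discrete T) f) g.
  by apply: contraNN fg => /(edge_of_join cf cg) ->.
have dT := discrete_partition T; have jp := join_partition (discrete T) f.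
rewrite card_above; last exact: join_partition.
by rewrite !card_join ?discrete_edge ?card_discrete.
Qed.

Lemma card_linked_le b U :
  #|[set P in parts T b | linked P U]| <= 'C(#|U|, 2) * stirling2 #|T|.-1 b.
Proof.
rewrite linked_bigcup -card_edge_draws; apply: card_bigcup_le => f /setIdP[_ /eqP cf].
by rewrite card_above_edge.
Qed.

Lemma card_linked_ge b U :
  'C(#|U|, 2) * stirling2 #|T|.-1 b <=
  #|[set P in parts T b | linked P U]| + 'C(#|U|, 2) ^ 2 * stirling2 #|T|.-2 b.
Proof.
rewrite linked_bigcup -card_edge_draws; apply: bonferroni => [f|f g].
  by case/setIdP=> _ /eqP cf; rewrite card_above_edge.
case/setIdP=> _ /eqP cf /setIdP[_ /eqP cg] fg; rewrite -(card_above_edges b cf cg fg).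
have dT := discrete_partition T; have jp := join_partition (discrete T) f.
(* A flat with both edges lies above the rank-two flat that they span. *)
apply/subset_leq_card/subsetP => P /setIP[/aboveP[PP Pf] /aboveP[_ Pg]].
have partP := parts_partition PP.
apply/aboveP; split=> //; rewrite finer_join // Pf.
by move: Pg; rewrite finer_join // => /andP[].
Qed.

End Linked.

(** * The bound [HM] as a number of flats *)

Section Count.
Variables n k : nat.
Hypotheses (k_gt0 : 0 < k).
Local Notation b := (n.+1 - k).

Definition initial : {set 'I_n} := [set i : 'I_n | i < k.+1].

(** The subtrahend counts the partitions that separate [initial], so the difference counts those
    linked to it. *)
Lemma HM_linked :
  0 < n -> HM n k = #|[set P in parts 'I_n b | linked P initial]| + 2.
Proof.
move=> n_gt0; rewrite /HM /brac /brac_sep prednK //; congr (_ + _).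
have -> : n - k.-1 = b by lia.
have -> : stirling2 n b = #|parts 'I_n b| by [].
rewrite -(cardsID [set P | linked P initial] (parts 'I_n b)).
have -> : stirling2_sep k.+1 n b = #|parts 'I_n b :\: [set P | linked P initial]|.
  apply: eq_card => P; rewrite !inE andbA [RHS]andbC.
  have [/andP[partP _] /=|//] := boolP (partition P _ && _).
  apply/idP/idP => [/forallP sep | nl].
    apply/negP => /(linkedP _ partP)[i [j [ij]]]; rewrite !inE => ik jk sij.
    by have := forallP (sep i) j; rewrite ik jk ij -/(same P i j) sij.
  apply/forallP => i; apply/forallP => j; apply/implyP => /and3P[ik jk ij].
  apply: contraNN nl => sij; apply/(linkedP _ partP); exists i, j.
  by rewrite !inE.
by rewrite addnK; apply: eq_card => P; rewrite !inE.
Qed.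

Lemma card_initial : k < n -> #|initial| = k.+1.
Proof.
move=> kn; have inj : injective (widen_ord kn) by move=> i j /(congr1 val) ij; apply: val_inj.
rewrite -[RHS]card_ord -(card_imset _ inj).
apply: eq_card => i; rewrite inE; apply/idP/imsetP => [ik | [j _ ->] //=].
by exists (Ordinal ik); rewrite ?inE //; apply: val_inj.
Qed.

(** Contracting [e] turns the flats containing it into partitions of [n] points. As [e] is not
    inside [U], the contraction is injective on [U], and a permutation moves the image of [U] to
    [initial]. *)
Lemma card_linked_HM (e U : {set 'I_n.+1}) :
  #|e| = 2 -> ~~ (e \subset U) -> #|U| = k.+1 ->
  #|[set F in parts 'I_n.+1 b | contains F e && linked F U]| + 2 = HM n k.
Proof.
move=> /eqP/cards2P[x [y [xy ->]]] + cU; rewrite subUset !sub1set.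
wlog yU : x y xy / y \notin U.
  move=> W; rewrite negb_and => /orP[xU | yU]; last by apply: W; rewrite // negb_and yU orbT.
  by rewrite setUC; apply: W; rewrite ?(eq_sym y) // negb_and xU orbT.
move=> _; have yx : y != x by rewrite eq_sym.
have [x' xx' ux'] := unlift_some yx.
(* The contraction deletes [y] and gives it the index [x'] that [x] has afterwards. *)
pose q0 z := odflt x' (unlift y z).
have q0l i : q0 (lift y i) = i by rewrite /q0 liftK.
have q0y : q0 y = x' by rewrite /q0 unlift_none.
have q0x : q0 x = x' by rewrite /q0 ux'.
have q0U : {in U &, injective q0}.
  have Ul z : z \in U -> exists i, z = lift y i.
    by case: (unliftP y z) => [i -> _|->]; [exists i | rewrite (negPf yU)].
  by move=> z w /Ul[i ->] /Ul[j ->]; rewrite !q0l => ->.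
have kn : k < n.
  by rewrite -cU -(card_in_imset q0U) -[leqRHS]card_ord max_card.
have [p pU] : exists p : {perm 'I_n}, p @: (q0 @: U) = initial.
  by apply: perm_of_sets; rewrite card_in_imset // card_initial.
pose q z := p (q0 z).
have q_surj i : exists z, q z = i.
  by exists (lift y (p^-1%g i)); rewrite /q q0l permKV.
have qU : q @: U = initial by rewrite -pU -imset_comp.
rewrite HM_linked; last by lia.
congr (_ + 2).
transitivity #|[set P in parts 'I_n b | linked (pull q P) U]|.
  (* The kernel of [q] identifies just [x] and [y], so lying above it means containing the edge. *)
  rewrite -(card_pull_set q_surj b (fun F => linked F U)); apply: eq_card => F; rewrite !inE.
  have [partF /=|//] := boolP (partition F _).
  have [_ /=|//] := boolP (#|F| == b); congr (_ && _); rewrite contains2 //.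
  apply/idP/finerP => [sxy z w|]; last by apply; rewrite same_kerp /q q0x q0y.
  rewrite same_kerp (inj_eq perm_inj).
  case: (unliftP y z) => [i ->|->]; case: (unliftP y w) => [j ->|->]; rewrite ?q0l ?q0y.
  - by move/eqP=> ->; apply: eqxx.
  - by move/eqP=> ->; rewrite -xx'.
  - by move/eqP=> <-; rewrite -xx' /same eq_sym.
  - by move=> _; apply: eqxx.
apply: eq_card => P; rewrite !inE; have [partP /=|//] := boolP (partition P _).
have pullP := kerp_partition (fun z => pblock P (q z)).
congr (_ && _); apply/(linkedP _ pullP)/(linkedP _ partP) => [[z [w [zw zU wU]]]|].
  rewrite same_pull => szw; exists (q z), (q w); split=> //.
  - by rewrite (inj_eq perm_inj); apply: contraNN zw => /eqP/q0U -> //.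
  - by rewrite -qU imset_f.
  - by rewrite -qU imset_f.
case=> i [j [ij]]; rewrite -qU => /imsetP[z zU iz] /imsetP[w wU jw] sij.
exists z, w; rewrite same_pull -iz -jw; split=> //.
by apply: contraNN ij; rewrite iz jw => /eqP ->.
Qed.

(** Union bound and Bonferroni over the pairs of prescribed points; [s] counts the partitions
    joining one given pair and [t] those joining two. *)
Lemma HM_bounds (s := stirling2 n.-1 b) (t := stirling2 n.-2 b) :
  k < n ->
  HM n k <= 'C(k.+1, 2) * s + 2 /\ 'C(k.+1, 2) * s + 2 <= HM n k + 'C(k.+1, 2) ^ 2 * t.
Proof.
move=> kn; rewrite HM_linked; last by lia.
have := card_linked_le b initial; have := card_linked_ge b initial.
rewrite card_initial // card_ord -/s -/t => ge le.
by rewrite leq_add2r addnAC leq_add2r.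
Qed.

End Count.

(** * Members missing a common edge of the heavy flats *)

Section Clump.
Variable T : finType.
Implicit Types (P F : {set {set T}}) (U : {set T}).

(** A version of [one_block] as a kernel; see [one_block_clump]. *)
Definition clump U := kerp (fun z => if z \in U then set0 else [set z]).

Lemma clump_partition U : partition (clump U) [set: T].
Proof. exact: kerp_partition. Qed.
#[local] Hint Resolve clump_partition : core.

Lemma same_clump U x y : same (clump U) x y = (x == y) || (x \in U) && (y \in U).
Proof.
rewrite same_kerp; have [->|xy] := eqVneq x y; first by rewrite eqxx.
case: (x \in U); case: (y \in U); rewrite ?eqxx //=.
- by apply/eqP/setP => /(_ y); rewrite !inE eqxx.
- by apply/eqP/setP => /(_ x); rewrite !inE eqxx.
- by apply/eqP/setP => /(_ x); rewrite !inE eqxx (negPf xy).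
Qed.

Lemma edges_clump U : edges (clump U) = draws U.
Proof.
apply/setP => e; rewrite !inE andbC; have [/cards2P[x [y [xy ->]]]|] := boolP (#|e| == 2).
  by rewrite contains2 // same_clump (negPf xy) subUset !sub1set andbT.
by rewrite !andbF.
Qed.

Lemma edges_clump_linked F U : (edges F :&: edges (clump U) != set0) = linked F U.
Proof.
rewrite edges_clump; apply/set0Pn/existsP => -[e]; rewrite !inE.
  by case/andP=> /andP[ce Fe] /andP[eU _]; exists e; rewrite inE eU ce.
by case/andP=> /andP[eU ce] Fe; exists e; rewrite !inE eU ce Fe.
Qed.

Lemma eq_clump P U :
  partition P [set: T] -> (forall x y, same P x y = (x == y) || (x \in U) && (y \in U)) ->
  P = clump U.
Proof.
move=> partP sP; apply: partition_eq => // x y.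
by rewrite sP same_clump.
Qed.

End Clump.

#[local] Hint Resolve clump_partition : core.

Section Pencil.
Variables (T : finType) (k h : nat).
Local Notation b := (#|T| - k).
Hypotheses (k_gt1 : 1 < k) (k_lt : k < #|T|).
(** The number [h] stands for [HM n k], for which this is [card_linked_HM]. *)
Hypothesis card_h : forall e U : {set T}, #|e| = 2 -> ~~ (e \subset U) -> #|U| = k.+1 ->
  #|[set F in parts T b | contains F e && linked F U]| + 2 = h.
Implicit Types (AA WW : {set {set {set T}}}) (A W F : {set {set T}}) (e U Y : {set T}).

Definition crossing AA :=
  forall P Q, P \in AA -> Q \in AA -> edges P :&: edges Q != set0.

(** This is the extremal family for an arbitrary edge; [HMfam] is the case of the vertices 0 and
    1. *)
Definition hilton_milner x y Y :=
  [set F in parts T b | contains F [set x; y] && linked F (x |: Y)]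
    :|: [set clump (x |: Y); clump (y |: Y)].

Definition is_hilton_milner AA := exists x y Y,
  [/\ x != y, x \notin Y, y \notin Y, #|Y| = k & AA = hilton_milner x y Y].

(** The two cliques miss the edge [[set x; y]], and they differ because a point of [Y] is joined to
    [x] in only one of them. *)
Lemma card_hilton_milner x y Y : x != y -> x \notin Y -> y \notin Y -> #|Y| = k ->
  #|hilton_milner x y Y| = h.
Proof.
move=> xy xY yY cY; have cU z : z \notin Y -> #|z |: Y| = k.+1 by move=> zY; rewrite cardsU1 zY cY.
have nexU : ~~ ([set x; y] \subset x |: Y).
  by rewrite subUset !sub1set !inE eqxx eq_sym (negPf xy) (negPf yY).
have neyU : ~~ ([set x; y] \subset y |: Y).
  by rewrite subUset !sub1set !inE eqxx (negPf xy) (negPf xY).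
have nc U : ~~ ([set x; y] \subset U) -> ~~ contains (clump U) [set x; y].
  rewrite contains2 // same_clump (negPf xy) /=.
  by rewrite subUset !sub1set.
rewrite -(card_h _ nexU) ?cU ?cards2 ?xy //.
have disj : [disjoint [set F in parts T b | contains F [set x; y] && linked F (x |: Y)]
     & [set clump (x |: Y); clump (y |: Y)]].
  rewrite disjoint_sym disjoints_subset; apply/subsetP => F /set2P[]->; rewrite inE;
  by apply/setIdP => -[_ /andP[cF _]]; move: cF; apply/negP/nc.
have /set0Pn[z zY] : Y != set0 by rewrite -card_gt0 cY; apply: ltnW.
have neC : clump (x |: Y) != clump (y |: Y).
  apply: contraTneq isT => /(congr1 (fun P => same P x z)).
  rewrite !same_clump !inE eqxx zY orbT (negPf xy) (negPf xY) /=.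
  by have [xz|] := eqVneq x z; rewrite ?andbT //; move: xY; rewrite xz zY.
by rewrite cardsU (disjoint_setI0 disj) cards0 subn0 cards2 neC.
Qed.

(* [WW] plays the role of the rank-two flats through [e] that meet all members of [AA]. *)
Section ThroughEdge.
Variables (AA WW : {set {set {set T}}}) (e : {set T}) (A0 : {set {set T}}).
Hypotheses (AA_parts : AA \subset parts T b) (AA_cross : crossing AA).
Hypotheses (card_e : #|e| = 2) (A0_AA : A0 \in AA) (A0_e : ~~ contains A0 e).
Hypothesis WW_rank2 : WW \subset parts T (#|T| - 2).
Hypothesis WW_e : forall W, W \in WW -> contains W e.
Hypothesis WW_cross : forall W A, W \in WW -> A \in AA -> edges W :&: edges A != set0.
Hypothesis WW_large : 'C(k.+1, 2) <= #|WW|.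

Let eT := join (discrete T) e.

Let eT_partition : partition eT [set: T] := join_partition _ _.
#[local] Hint Resolve eT_partition : core.

(** This set depends on [WW] and [e] only, so all members missing [e] agree outside [e] by
    [avoiding]. *)
Let support := [set z | (z \notin e) && [exists W in WW, [exists w, (w != z) && same W z w]]].

(** Each [W] contains [e] and, since it meets [A], another edge [f] of [A]; having rank two, it is
    their span. So [WW] has at most as many elements as [A] has edges, and [WW_large] forces
    equality. *)
Lemma WW_join A : A \in AA -> ~~ contains A e ->
  WW = join eT @: edges A /\ 'C(k.+1, 2) <= #|edges A|.
Proof.
move=> AAA nAe; have partA := parts_partition (subsetP AA_parts _ AAA).
have cA : #|A| = b by have := subsetP AA_parts _ AAA; rewrite inE => /andP[_ /eqP].
have sub : WW \subset join eT @: edges A.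
  apply/subsetP => W WWW; have WT := subsetP WW_rank2 _ WWW.
  have partW := parts_partition WT.
  have cW : #|W| = #|T| - 2 by move: WT; rewrite inE => /andP[_ /eqP].
  have /set0Pn[f /setIP[Wf Af]] := WW_cross WWW AAA.
  have /setIdP[/eqP cf cWf] := Wf; have /setIdP[_ cAf] := Af.
  have nef : ~~ contains eT f.
    by apply: contraNN nAe => /(edge_of_join card_e cf) <-.
  apply/imsetP; exists f => //; apply/esym/finer_eq => //.
    by rewrite !finer_join // /eT ?finer_discrete ?cWf ?WW_e.
  by rewrite !card_join ?discrete_edge ?card_discrete ?cW ?subn2 //.
have leA : #|edges A| <= 'C(k.+1, 2) by apply: card_edges_le partA _; rewrite cA subKn // ltnW.
have leW := subset_leq_card sub; have leI := leq_imset_card (join eT) (edges A).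
split; last by apply: leq_trans leI; apply: leq_trans leW.
apply/eqP; rewrite eqEcard sub; apply: leq_trans WW_large; exact: leq_trans leA.
Qed.

(** Having the maximal number of edges, [A] is a clique on [k.+1] points. Outside [e], its points
    are those that some span of [e] and an edge of [A] does not isolate. *)
Lemma avoiding A : A \in AA -> ~~ contains A e ->
  exists U, [/\ A = clump U, #|U| = k.+1 & U :\: e = support].
Proof.
move=> AAA nAe; have [WWA maxA] := WW_join AAA nAe.
have partA := parts_partition (subsetP AA_parts _ AAA).
have cA : #|A| = b by have := subsetP AA_parts _ AAA; rewrite inE => /andP[_ /eqP].
have rkA : #|T| - #|A| = k by rewrite cA subKn // ltnW.
have [|U cU sA] := card_edges_max partA rkA _ maxA; first exact: ltnW.
have AU := eq_clump partA sA.
exists U; split=> //; apply/setP => z; rewrite !inE; have [//|ze /=] := boolP (z \in e).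
have finer_refl W : finer W W by apply/finerP.
apply/idP/existsP => [zU | [W /andP[]]].
  have /set0Pn[w] : U :\ z != set0.
    by rewrite -card_gt0; have := cardsD1 z U; rewrite zU cU add1n => -[<-]; apply: ltnW.
  rewrite !inE => /andP[wz wU]; exists (join eT [set z; w]).
  have czw : #|[set z; w]| = 2 by rewrite cards2 eq_sym wz.
  apply/andP; split.
    rewrite WWA; apply: imset_f; rewrite AU edges_clump; apply/drawsP.
    by exists z, w; rewrite eq_sym.
  apply/existsP; exists w; rewrite wz -contains2 //=.
  by have := finer_refl (join eT [set z; w]); rewrite finer_join // => /andP[].
rewrite WWA AU edges_clump => /imsetP[f fU ->] /existsP[w /andP[wz]].
have /setIdP[fsU _] := fU; apply: contraLR => zU.
(* A point outside [e] and [U] is isolated in [eT], and the edge [f] inside [U] does not reach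
   it. *)
have eT_z v : same eT z v -> v = z.
  move=> szv; apply/esym/eqP; rewrite -same_discrete.
  apply: (join_disjoint (discrete_partition T) _ szv).
  by rewrite singleton_discrete disjoints1.
apply: contraNN wz => szw; apply/eqP/eT_z.
apply: (join_disjoint (join_partition _ _) _ szw).
rewrite disjoint_subset; apply/subsetP => v; rewrite -sameE // => /eT_z ->.
by rewrite inE; apply: contraNN zU => /(subsetP fsU).
Qed.

(** Members through [e] are linked to the clique [U0] of [A0] and are counted by [card_h]. It
    remains to see that at most two members miss [e]. *)
Lemma pencil_bound : #|AA| <= h /\ (#|AA| = h -> is_hilton_milner AA).
Proof.
have [U0 [A0U cU0 U0e]] := avoiding A0_AA A0_e.
have neU U : ~~ contains (clump U) e -> ~~ (e \subset U).
  have /cards2P[x [y [xy ->]]] := introT eqP card_e.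
  by rewrite contains2 // same_clump (negPf xy) subUset !sub1set.
have neU0 : ~~ (e \subset U0) by apply: neU; rewrite -A0U.
have link A : A \in AA -> linked A U0.
  by move=> AAA; rewrite -edges_clump_linked -A0U; apply: AA_cross.
pose BB := [set F in parts T b | contains F e && linked F U0].
have cBB : #|BB| + 2 = h by apply: card_h.
have inBB A : A \in AA -> contains A e -> A \in BB.
  by move=> AAA Ae; rewrite inE (subsetP AA_parts _ AAA) Ae link.
(* If [U0] avoids [e], it equals [support], so [A0] is the only member missing [e] and the bound is
   strict. *)
have [disj|] := boolP [disjoint U0 & e].
  have U0s : U0 = support by rewrite -U0e; apply/esym/setDidPl.
  have sub : AA \subset BB :|: [set clump U0].
    apply/subsetP => A AAA; rewrite in_setU; have [Ae|nAe] := boolP (contains A e).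
      by rewrite inBB.
    have [U [-> cU Ue]] := avoiding AAA nAe; rewrite orbC inE.
    suff -> : U = U0 by rewrite eqxx.
    apply/esym/eqP; rewrite eqEcard cU cU0 leqnn andbT U0s -Ue; exact: subsetDl.
  have := subset_leq_card sub; have := leq_card_setU BB [set clump U0].
  rewrite cards1 => -[le _] le'.
  have lt : #|AA| < h by rewrite -cBB addn2 ltnS -addn1 (leq_trans le').
  by split; [exact: ltnW | move=> eqh; rewrite eqh ltnn in lt].
(* Otherwise [U0] contains exactly one end [x] of [e], since [A0] misses [e]. *)
rewrite -setI_eq0 => /set0Pn[x /setIP[xU0 xe]].
have [y xy exy] : exists2 y, x != y & e = [set x; y].
  have /cards2P[u [v [uv euv]]] := introT eqP card_e.
  by move: xe; rewrite euv => /set2P[->|->]; [exists v | exists u; rewrite 1?eq_sym // setUC].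
have yU0 : y \notin U0 by move: neU0; rewrite exy subUset !sub1set xU0.
pose Y := U0 :\ x.
have sY : support = Y.
  rewrite -U0e exy; apply/setP => z; rewrite !inE negb_or.
  have [->|_] := eqVneq z y; last by rewrite andbT.
  by rewrite (negPf yU0) !andbF.
have xY : x \notin Y by rewrite !inE eqxx.
have yY : y \notin Y by rewrite !inE (negPf yU0) andbF.
have U0Y : U0 = x |: Y by rewrite setD1K.
have cY : #|Y| = k by have := cardsD1 x U0; rewrite xU0 cU0 => -[].
have sub : AA \subset hilton_milner x y Y.
  apply/subsetP => A AAA; rewrite in_setU; have [Ae|nAe] := boolP (contains A e).
    by have := inBB A AAA Ae; rewrite /BB exy U0Y => ->.
  have [U [AU cU Ue]] := avoiding AAA nAe; rewrite orbC AU.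
  have neqU : ~~ (e \subset U) by apply: neU; rewrite -AU.
  have YU : Y \subset U by rewrite -sY -Ue subsetDl.
  have /set0Pn[u /setDP[uU uY]] : U :\: Y != set0.
    rewrite setD_eq0; apply: contraTN isT => /subset_leq_card.
    by rewrite cU cY ltnn.
  have Uu : U = u |: Y.
    apply/esym/eqP; rewrite eqEcard subUset sub1set uU YU cardsU1 uY cU cY.
    by rewrite add1n leqnn.
  (* The one point of [U] outside [Y] must be an end of [e], which leaves just the two cliques of
     the extremal family. *)
  have : u \in e by apply: contraNT uY => ue; rewrite -sY -Ue inE ue.
  by rewrite exy Uu => /set2P[]->; rewrite !inE eqxx ?orbT.
have cG := card_hilton_milner xy xY yY cY.
split; first by rewrite -cG; apply: subset_leq_card.
move=> eqh; exists x, y, Y; split=> //.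
by apply/eqP; rewrite eqEcard sub cG eqh leqnn.
Qed.

End ThroughEdge.

End Pencil.

(** * Rank two and large rank *)

Section Families.
Variable T : finType.
Implicit Types (AA : {set {set {set T}}}) (A W X : {set {set T}}) (e f : {set T}).

(** In terms of edges, this says that the meet of the family has rank zero. *)
Definition spread AA := forall e, #|e| = 2 -> exists2 A, A \in AA & ~~ contains A e.

Lemma card_parts b A : A \in parts T b -> #|A| = b.
Proof. by case/setIdP=> _ /eqP. Qed.

Lemma rank2 h AA :
  2 < #|T| -> 5 <= h ->
  (forall e U : {set T}, #|e| = 2 -> ~~ (e \subset U) -> #|U| = 3 ->
    #|[set F in parts T (#|T| - 2) | contains F e && linked F U]| + 2 = h) ->
  AA != set0 -> AA \subset parts T (#|T| - 2) -> crossing AA -> spread AA ->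
  #|AA| <= h /\ (#|AA| = h -> is_hilton_milner 2 AA).
Proof.
move=> T2 h5 card_h /set0Pn[L LAA] AAp AAc AAs.
pose AAe e := [set A in AA | contains A e].
have [/existsP[e /andP[/eqP ce le3]]|/existsPn few] :=
  boolP [exists e : {set T}, (#|e| == 2) && (3 <= #|AAe e|)].
  have [A0 A0AA A0e] := AAs e ce.
  have AAeS A : A \in AAe e -> A \in AA by case/setIdP.
  (* The members through [e] are themselves rank-two flats meeting all members, and three of them
     suffice as ['C(3, 2)] is 3. *)
  apply: (@pencil_bound _ 2 h _ _ card_h AA (AAe e) e A0) => //.
  - by apply/subsetP => A /AAeS/(subsetP AAp).
  - by move=> W /setIdP[].
  - by move=> W A /AAeS WAA AAA; apply: AAc.
have partL := parts_partition (subsetP AAp _ LAA).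
have cL := card_parts (subsetP AAp _ LAA).
have sub : AA \subset L |: \bigcup_(e in edges L) (AAe e :\ L).
  apply/subsetP => A AAA; rewrite !inE; have [//|AL /=] := eqVneq A L.
  have /set0Pn[e /setIP[Le Ae]] := AAc _ _ LAA AAA.
  by apply/bigcupP; exists e; rewrite // !inE AL AAA; case/setIdP: Ae.
(* Each of the at most three edges of [L] lies in at most one other member. *)
have le4 : #|AA| <= 1 + 'C(3, 2) * 1.
  apply: leq_trans (subset_leq_card sub) _; apply: leq_trans (leq_card_setU _ _) _.
  rewrite cards1 leq_add2l; apply: leq_trans (card_bigcup_le (c := 1) _) _.
    move=> e Le; have /setIdP[/eqP ce cLe] := Le; have := few e.
    rewrite ce eqxx /= -ltnNge (cardsD1 L (AAe e)) inE LAA cLe.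
    by rewrite add1n ltnS.
  rewrite !muln1; apply: card_edges_le partL _; rewrite cL subKn //; exact: ltnW.
have lt : #|AA| < h by apply: leq_trans h5.
by split; [exact: ltnW | move=> eqh; rewrite eqh ltnn in lt].
Qed.

(** Each member shares with [X] an edge [f] not in [W], hence lies above [join W f], whose rank is
    one more than that of [W]. *)
Lemma card_above_disjoint b W X AA :
  partition W [set: T] -> edges W :&: edges X = set0 ->
  AA \subset above b W -> (forall A, A \in AA -> edges A :&: edges X != set0) ->
  #|AA| <= #|edges X| * stirling2 #|W|.-1 b.
Proof.
move=> partW disj AAW AAX.
have notW f : f \in edges X -> ~~ contains W f.
  move=> Xf; have /setIdP[cf _] := Xf; apply/negP => Wf.
  have : f \in edges W :&: edges X by apply/setIP; split=> //; apply/setIdP.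
  by rewrite disj inE.
apply: leq_trans (card_bigcup_le (F := fun f => above b (join W f)) (c := stirling2 #|W|.-1 b) _).
  apply/subset_leq_card/subsetP => A AAA.
  have /aboveP[Ap WA] := subsetP AAW _ AAA; have partA := parts_partition Ap.
  have /set0Pn[f /setIP[/setIdP[/eqP cf Af] Xf]] := AAX _ AAA.
  by apply/bigcupP; exists f => //; apply/aboveP; split; rewrite // finer_join // WA Af.
move=> f Xf; have /setIdP[/eqP cf _] := Xf.
by rewrite card_above // card_join // notW.
Qed.

End Families.

Section LargeRank.
Variables (T : finType) (k h : nat).
Local Notation b := (#|T| - k).
Local Notation m := 'C(k.+1, 2).
Local Notation s2 := (stirling2 (#|T| - 2) b).
Local Notation s3 := (stirling2 (#|T| - 3) b).
Hypotheses (k_gt2 : 2 < k) (k_lt : k < #|T|) (b_large : m ^ 3 + m ^ 2 <= b).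
Hypothesis card_h : forall e U : {set T}, #|e| = 2 -> ~~ (e \subset U) -> #|U| = k.+1 ->
  #|[set F in parts T b | contains F e && linked F U]| + 2 = h.
Hypothesis h_large : m * s2 + 2 <= h + m ^ 2 * s3.
Hypothesis rank2_le5 : forall WW : {set {set {set T}}},
  WW != set0 -> WW \subset parts T (#|T| - 2) -> crossing WW -> spread WW -> #|WW| <= 5.

Variable AA : {set {set {set T}}}.
Hypotheses (AA0 : AA != set0) (AA_parts : AA \subset parts T b).
Hypotheses (AA_cross : crossing AA) (AA_spread : spread AA).
Implicit Types (A W X : {set {set T}}) (e f : {set T}).

Let m_ge6 : 6 <= m.
Proof. by rewrite (_ : 6 = 'C(4, 2)) // leq_bin2l. Qed.

Let AW W := AA :&: above b W.

(** The threshold is the bound of [AW_le]: a flat above it cannot miss any [X] that has at most [m]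
    edges and meets all of [AA]. *)
Definition heavy := [set W in parts T (#|T| - 2) | m * s3 < #|AW W|].

Lemma edges_le A : A \in AA -> #|edges A| <= m.
Proof.
move=> /(subsetP AA_parts) Ap; apply: card_edges_le (parts_partition Ap) _.
by rewrite (card_parts Ap) subKn // ltnW.
Qed.

Lemma AW_le W X : W \in parts T (#|T| - 2) -> edges W :&: edges X = set0 ->
  (forall A, A \in AA -> edges A :&: edges X != set0) -> #|edges X| <= m ->
  #|AW W| <= m * s3.
Proof.
move=> Wp disj AAX leX; have cW := card_parts Wp.
apply: leq_trans (card_above_disjoint (parts_partition Wp) disj (subsetIr _ _) _) _.
  by move=> A /setIP[AAA _]; apply: AAX.
by rewrite cW -subnS leq_mul2r leX orbT.
Qed.

Lemma heavy_meets W A : W \in heavy -> A \in AA -> edges W :&: edges A != set0.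
Proof.
case/setIdP=> Wp; rewrite ltnNge => nle AAA; apply: contra nle => /eqP disj.
apply: AW_le Wp disj _ (edges_le AAA) => A' AAA'; exact: AA_cross.
Qed.

(** By [heavy_meets] a heavy flat can itself play the part of [X] in [AW_le], since it has at most 3
    edges. *)
Lemma heavy_crossing : crossing heavy.
Proof.
move=> P Q PH QH; have /setIdP[Pp _] := PH; have /setIdP[Qp] := QH.
rewrite ltnNge; apply: contra => /eqP disj.
apply: (@AW_le Q P Qp); first by rewrite setIC.
  by move=> A AAA; rewrite setIC; apply: heavy_meets.
apply: leq_trans (leq_trans _ m_ge6); last exact: (isT : 3 <= 6).
apply: (@card_edges_le _ P 2); first exact: parts_partition Pp.
by rewrite (card_parts Pp) subKn // (leq_trans _ k_lt) // ltnS ltnW // ltnW.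
Qed.

(** A member shares an edge [e] with the fixed [A1] and an edge [f] with a member missing [e], so it
    lies above the rank-two flat [J e f]. If that flat is not heavy, there are at most [m] choices
    for each edge and [m * s3] members above. *)
Lemma card_AA_le : #|AA| <= #|heavy| * s2 + m * (m * (m * s3)).
Proof.
have [A1 A1AA] := set0Pn _ AA0.
(* The default [A1] never occurs for an edge [e], by [AA_spread]. *)
pose av e := odflt A1 [pick A in AA | ~~ contains A e].
have avP e : #|e| = 2 -> av e \in AA /\ ~~ contains (av e) e.
  move=> ce; rewrite /av; case: pickP => [A /andP[] //|no].
  by have [A AAA Ae] := AA_spread ce; have := no A; rewrite AAA Ae.
pose J e f := join (join (discrete T) e) f.
pose light W := if W \in heavy then set0 else AW W.
have sub : AA \subset (\bigcup_(W in heavy) AW W)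
    :|: \bigcup_(e in edges A1) \bigcup_(f in edges (av e)) light (J e f).
  apply/subsetP => A AAA; have Ap := subsetP AA_parts _ AAA.
  have partA := parts_partition Ap.
  have /set0Pn[e /setIP[eA1 /setIdP[/eqP ce Ae]]] := AA_cross A1AA AAA.
  have [avAA _] := avP e ce.
  have /set0Pn[f /setIP[fav /setIdP[/eqP cf Af]]] := AA_cross avAA AAA.
  have AJ : A \in AW (J e f).
    rewrite inE AAA; apply/aboveP; split=> //.
    by rewrite !finer_join // finer_discrete Ae Af.
  have [JH|JH] := boolP (J e f \in heavy); rewrite inE; apply/orP; [left|right].
    by apply/bigcupP; exists (J e f).
  apply/bigcupP; exists e => //; apply/bigcupP; exists f => //.
  by rewrite /light (negPf JH).
apply: leq_trans (subset_leq_card sub) _; apply: leq_trans (leq_card_setU _ _) _.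
apply: leq_add.
  apply: card_bigcup_le => W /setIdP[Wp _]; rewrite -(card_parts Wp).
  rewrite -(card_above _ (parts_partition Wp)); apply: subset_leq_card; exact: subsetIr.
apply: leq_trans (leq_mul (edges_le A1AA) (leqnn _)); apply: card_bigcup_le => e eA1.
have /setIdP[/eqP ce _] := eA1; have [avAA nave] := avP e ce.
apply: leq_trans (leq_mul (edges_le avAA) (leqnn _)); apply: card_bigcup_le => f fav.
rewrite /light; case: ifPn => [_|]; first by rewrite cards0.
have /setIdP[/eqP cf avf] := fav.
have nef : ~~ contains (join (discrete T) e) f.
  by apply: contraNN nave => /(edge_of_join ce cf) fe; rewrite -{2}fe.
have Jp : J e f \in parts T (#|T| - 2).
  by apply/setIdP; split; rewrite /J // !card_join ?discrete_edge ?card_discrete // subn2.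
by rewrite inE Jp /= -leqNgt.
Qed.

Lemma large_rank : #|AA| <= h /\ (#|AA| = h -> is_hilton_milner k AA).
Proof.
have [ltm|lem] := ltnP #|heavy| m.
  have lt : #|AA| < h.
    (* One of the [m] terms [s2] in [h_large] is left over, and it absorbs both error terms, of
       sizes [m ^ 3 * s3] and [m ^ 2 * s3]. *)
    have bs : b * s3 <= s2.
      have := stirling2_grow (#|T| - 3) b; rewrite -subSn //.
      by apply: leq_trans k_lt; apply: leqW.
    have bs' : (m ^ 3 + m ^ 2) * s3 <= s2.
      by apply: leq_trans bs; rewrite leq_mul2r b_large orbT.
    have hs : #|heavy| * s2 <= m.-1 * s2.
      by rewrite leq_mul2r -ltnS prednK ?ltm ?orbT //; apply: leq_trans m_ge6.
    have ms : m * s2 = m.-1 * s2 + s2.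
      by rewrite -mulSnr prednK //; apply: leq_trans m_ge6.
    have leA := card_AA_le; move: h_large bs' hs ms leA.
    rewrite mulnDl !expnS expn0 !muln1 -!mulnA.
    move: (m * s2) (m.-1 * s2) (#|heavy| * s2) (m * (m * (m * s3))) (m * (m * s3)) s2 #|AA|.
    by clear; lia.
  by split; [exact: ltnW | move=> eqh; rewrite eqh ltnn in lt].
have heavy0 : heavy != set0.
  by rewrite -card_gt0; apply: leq_trans lem; apply: leq_trans m_ge6.
have heavyS : heavy \subset parts T (#|T| - 2) by apply/subsetP => W /setIdP[].
have [/existsP[e /andP[/eqP ce /forallP heavy_e]]|/existsPn noe] :=
  boolP [exists e : {set T}, (#|e| == 2) && [forall W in heavy, contains W e]].
  have [A0 A0AA A0e] := AA_spread ce.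
  apply: (@pencil_bound _ k h _ k_lt card_h AA heavy e A0) => //.
  - exact: ltnW.
  - by move=> W WH; apply: implyP (heavy_e W) WH.
  - exact: heavy_meets.
(* Without a common edge the heavy flats fall under the rank-two bound, which contradicts that there
   are at least [m >= 6] of them. *)
have : #|heavy| <= 5.
  apply: rank2_le5 => //; first exact: heavy_crossing.
  move=> e ce; have := noe e; rewrite ce eqxx /= => /forallPn[W].
  by rewrite negb_imply => /andP[WH We]; exists W.
by move/(leq_trans lem)/(leq_trans m_ge6).
Qed.

End LargeRank.

(** * Flats of the complete graph *)

Lemma stirling2_diag a : stirling2 a a = 1.
Proof.
rewrite -(cards1 (discrete 'I_a)); apply: eq_card => P; rewrite !inE.
have dT := discrete_partition 'I_a.
apply/andP/eqP => [[partP /eqP cP]|->].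
  by apply/esym/finer_eq; rewrite ?finer_discrete // card_discrete card_ord cP.
by rewrite dT card_discrete card_ord.
Qed.

Lemma stirling2_small a c : a < c -> stirling2 a c = 0.
Proof.
move=> ac; apply: eq_card0 => P; rewrite !inE; apply/negP => /andP[partP /eqP cP].
by have := card_partition_le partP; rewrite card_ord cP leqNgt ac.
Qed.

(** For [k = 2] the error term of [HM_bounds] vanishes and [s] is 1, so both bounds equal 3 + 2. *)
Lemma HM_rank2 n : 3 <= n -> HM n 2 = 5.
Proof.
move=> n3; have [le ge] := HM_bounds (isT : 0 < 2) (n3 : 2 < n); move: le ge.
have -> : n.+1 - 2 = n.-1 by rewrite subSS subn1.
rewrite stirling2_diag stirling2_small; last by rewrite -subn2 -subn1 ltn_sub2l // ltnW.
by rewrite muln0 addn0 => le ge; apply/eqP; rewrite eqn_leq le ge.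
Qed.

Section Flats.
Variable n : nat.
Implicit Types (P Q F : {set {set 'I_n.+1}}) (A : {set {set {set 'I_n.+1}}}).
Implicit Types (U Y : {set 'I_n.+1}).

Lemma flats_parts k : k <= n -> flats n k = parts 'I_n.+1 (#|'I_n.+1| - k).
Proof.
move=> kn; apply/setP => P; rewrite !inE card_ord; have [partP /=|//] := boolP (partition P _).
have := card_partition_le partP; rewrite card_ord /rk; move: #|P| => c cn; apply/eqP/eqP; lia.
Qed.

Lemma one_block_clump U : U != set0 -> one_block U = clump U.
Proof.
move=> /set0Pn[u uU]; have cp := clump_partition U.
have pb x : pblock (clump U) x = if x \in U then U else [set x].
  apply/setP => y; rewrite -sameE // same_clump.
  have [xU /=|xU] := boolP (x \in U); last by rewrite orbF inE eq_sym.
  by have [<-|//] := eqVneq x y; rewrite xU.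
apply/setP => B; rewrite -(imset_pblock cp); apply/setU1P/imsetP => [[->|/imsetP[x]]|[x _ ->]].
- by exists u; rewrite ?inE // pb uU.
- by rewrite inE => xU ->; exists x; rewrite ?inE // pb (negPf xU).
- by rewrite pb; case: ifPn => xU; [left | right; apply: imset_f; rewrite inE].
Qed.

Lemma rk_gt0 P : partition P [set: 'I_n.+1] -> (0 < rk P) = (edges P != set0).
Proof. by move=> partP; rewrite edges_neq0 // card_ord subn_gt0. Qed.

Lemma rk_meet_gt0 P Q :
  partition P [set: 'I_n.+1] -> partition Q [set: 'I_n.+1] ->
  (0 < rk (meet P Q)) = (edges P :&: edges Q != set0).
Proof.
move=> partP partQ; rewrite rk_gt0; last exact: meet_partition.
(* [edges] and [flat_edges] are convertible. *)
by rewrite [edges (meet P Q)]flat_edges_meet.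
Qed.

Lemma intersecting_crossing k A : k <= n -> intersecting k A ->
  [/\ A != set0, A \subset parts 'I_n.+1 (#|'I_n.+1| - k) & crossing A].
Proof.
move=> kn [A0 Ap AI]; rewrite -flats_parts //; split=> // P Q PA QA.
have part F : F \in A -> partition F [set: 'I_n.+1].
  by move/(subsetP Ap); rewrite inE => /andP[].
by rewrite -rk_meet_gt0 ?part // AI.
Qed.

(** An edge common to all members would be an edge of their meet. *)
Lemma bigmeet_spread k A : A \subset flats n k -> rk (bigmeet A) = 0 -> spread A.
Proof.
move=> Ap rk0 e ce.
have [/existsP[P /andP[PA Pe]]|/existsPn noP] := boolP [exists P in A, ~~ contains P e].
  by exists P.
suff /andP[part Ke] : partition (bigmeet A) [set: 'I_n.+1] && (e \in edges (bigmeet A)).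
  suff : 0 < rk (bigmeet A) by rewrite rk0.
  by rewrite rk_gt0 //; apply/set0Pn; exists e.
(* The one-block partition, which starts the iterated meet, contains every edge. *)
apply: (big_ind (fun R => partition R [set: 'I_n.+1] && (e \in edges R))).
- apply/andP; split; last first.
    rewrite inE ce eqxx; apply/existsP; exists [set: 'I_n.+1].
    by rewrite inE eqxx subsetT.
  rewrite /partition /cover big_set1 eqxx trivIset1 inE eq_sym.
  by apply/set0Pn; exists ord0.
- move=> P Q /andP[partP Pe] /andP[partQ Qe]; rewrite meet_partition //.
  by rewrite [edges (meet P Q)]flat_edges_meet; apply/setIP.
- move=> P PA; have := subsetP Ap _ PA; rewrite inE => /andP[-> _] /=.
  by rewrite inE ce eqxx; have := noP P; rewrite PA negbK.
Qed.

Lemma atom01_refines F : partition F [set: 'I_n.+1] ->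
  refines (atom01 n) F = contains F [set v0 n; v1 n].
Proof.
move=> partF; apply/forallP/idP => [/(_ [set v0 n; v1 n])|cF B].
  by rewrite !inE eqxx.
apply/implyP => /setU1P[-> //|/imsetP[x _ ->]].
by apply/existsP; exists (pblock F x); rewrite pblockT_mem // sub1set pblock_self.
Qed.

Lemma HMfam_hilton_milner k Y : k <= n -> HMfam k Y = hilton_milner k (v0 n) (v1 n) Y.
Proof.
move=> kn; have ne z : z |: Y != set0 by apply/set0Pn; exists z; rewrite !inE eqxx.
rewrite /HMfam /hilton_milner !one_block_clump // flats_parts //; congr (_ :|: _).
apply/setP => F; rewrite !in_set; have [/andP[partF _] /=|//] := boolP (partition F _ && _).
by rewrite atom01_refines // rk_meet_gt0 // edges_clump_linked.
Qed.

(** * The action of vertex permutations *)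

Lemma perm_flat_inj (s : {perm 'I_n.+1}) : injective (perm_flat s).
Proof. by apply: imset_inj; apply: imset_inj; apply: perm_inj. Qed.

Lemma perm_flat_partition (s : {perm 'I_n.+1}) P :
  partition P [set: 'I_n.+1] -> partition (perm_flat s P) [set: 'I_n.+1].
Proof.
have sT : s @: [set: 'I_n.+1] = [set: 'I_n.+1].
  by apply/setP => x; rewrite inE -[x](permKV s) imset_f.
by rewrite -{2}sT imset_partition //; apply: perm_inj.
Qed.

Lemma same_perm_flat (s : {perm 'I_n.+1}) P x y : partition P [set: 'I_n.+1] ->
  same (perm_flat s P) (s x) (s y) = same P x y.
Proof.
move=> partP; have partS := perm_flat_partition s partP.
apply/(same_blockP partS)/(same_blockP partP) => [[_ /imsetP[B BP ->]]|[B BP [xB yB]]].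
  by rewrite !mem_imset //; [exists B | apply: perm_inj | apply: perm_inj].
by exists (s @: B); rewrite ?imset_f.
Qed.

Lemma perm_flat_clump (s : {perm 'I_n.+1}) U : perm_flat s (clump U) = clump (s @: U).
Proof.
apply: eq_clump => [|x y]; first exact: perm_flat_partition.
rewrite -[x](permKV s) -[y](permKV s) same_perm_flat // same_clump.
by rewrite !mem_imset ?(inj_eq perm_inj) ?permKV //; apply: perm_inj.
Qed.

(** Inclusion is enough, because the two families have equal size in the application. *)
Lemma perm_flat_hilton_milner (s : {perm 'I_n.+1}) k x y Y :
  [set perm_flat s F | F in hilton_milner k x y Y] \subset hilton_milner k (s x) (s y) (s @: Y).
Proof.
have sU z : s @: (z |: Y) = s z |: s @: Y by rewrite imsetU1.
apply/subsetP => _ /imsetP[F FG ->]; move: FG; rewrite /hilton_milner => /setUP[|/set2P[]->].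
- case/setIdP=> Fp /andP[Fxy FU]; have partF := parts_partition Fp.
  have partS := perm_flat_partition s partF.
  apply/setUP; left; apply/setIdP; split.
    apply/setIdP; split=> //; rewrite card_imset ?(card_parts Fp) //.
    by apply: imset_inj; apply: perm_inj.
  rewrite contains2 // same_perm_flat // -contains2 // Fxy -sU /=.
  have [u [v [uv uU vU suv]]] := linkedP _ partF FU.
  apply/linkedP => //; exists (s u), (s v).
  by rewrite (inj_eq perm_inj) uv !imset_f // same_perm_flat.
- by rewrite perm_flat_clump sU !inE eqxx ?orbT.
- by rewrite perm_flat_clump sU !inE eqxx ?orbT.
Qed.

Section Conclusion.
Variable k : nat.
Hypotheses (k_gt1 : 1 < k) (k_lt : k < n).

Lemma card_hilton_milner_HM x y Y :
  x != y -> x \notin Y -> y \notin Y -> #|Y| = k -> #|hilton_milner k x y Y| = HM n k.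
Proof.
move=> xy xY yY cY; apply: card_hilton_milner => // [e U ce eU cU].
by rewrite card_ord; apply: card_linked_HM => //; apply: ltnW.
Qed.

Lemma isomorphic_hilton_milner A Y :
  Y \subset ~: [set v0 n; v1 n] -> #|Y| = k ->
  (#|A| = HM n k -> is_hilton_milner k A) -> #|A| = HM n k <-> isomorphic A (HMfam k Y).
Proof.
move=> Y01 cY maxA; have kn := ltnW k_lt; rewrite HMfam_hilton_milner //.
have v01 : v0 n != v1 n.
  by rewrite -val_eqE /= inordK // ltnS; apply: leq_trans k_lt.
have v0Y : v0 n \notin Y.
  by apply/negP => /(subsetP Y01); rewrite !inE eqxx.
have v1Y : v1 n \notin Y.
  by apply/negP => /(subsetP Y01); rewrite !inE eqxx orbT.
have cG := card_hilton_milner_HM v01 v0Y v1Y cY.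
split=> [/maxA[x [y [Z [xy xZ yZ cZ ->]]]]|[s sA]]; last first.
  by rewrite -cG -sA card_imset //; apply: perm_flat_inj.
(* A permutation taking [x], [y] and [Z] to 0, 1 and [Y] maps one extremal family into the other. *)
have [|||p] := @perm_of_seqs _ (x :: y :: enum Z) (v0 n :: v1 n :: enum Y).
- by rewrite /= enum_uniq inE !mem_enum negb_or xy xZ yZ.
- by rewrite /= enum_uniq inE !mem_enum negb_or v01 v0Y v1Y.
- by rewrite /= -!cardE cZ cY.
case=> px py pZ; have pZY : p @: Z = Y.
  apply/setP => w; rewrite -[RHS]mem_enum -pZ.
  apply/imsetP/mapP => -[z zZ ->]; exists z => //; first by rewrite mem_enum.
  by rewrite -mem_enum.
exists p; apply/eqP; rewrite eqEcard -{1}px -{1}py -{1}pZY perm_flat_hilton_milner.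
by rewrite card_imset ?cG ?card_hilton_milner_HM ?leqnn //; apply: perm_flat_inj.
Qed.

End Conclusion.

End Flats.

Theorem theorem1p5 :
  (forall n k m : nat,
     3 <= k ->
     m = 'C(k.+1, 2) ->
     3 * (m ^ 3 + 'C(m, 2)) <= n.+1 - k ->
     forall A : {set {set {set 'I_n.+1}}},
       intersecting k A -> rk (bigmeet A) = 0 ->
       #|A| <= HM n k /\
       (forall Y : {set 'I_n.+1},
          Y \subset ~: [set v0 n; v1 n] -> #|Y| = k ->
          (#|A| = HM n k <-> isomorphic A (HMfam k Y)))) /\
  (forall n : nat,
     3 <= n ->
     (forall A : {set {set {set 'I_n.+1}}},
        intersecting 2 A -> rk (bigmeet A) = 0 ->
        #|A| <= HM n 2 /\
        (forall Y : {set 'I_n.+1},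
           Y \subset ~: [set v0 n; v1 n] -> #|Y| = 2 ->
           (#|A| = HM n 2 <-> isomorphic A (HMfam 2 Y)))) /\
     HM n 2 = 5).
Proof.
have card_h n k : 0 < k -> forall e U : {set 'I_n.+1}, #|e| = 2 -> ~~ (e \subset U) ->
    #|U| = k.+1 ->
    #|[set F in parts 'I_n.+1 (#|'I_n.+1| - k) | contains F e && linked F U]| + 2 = HM n k.
  by move=> k0 e U ce eU cU; rewrite card_ord; apply: card_linked_HM.
(* This serves twice: as the claim for [k = 2], and as the bound 5 for heavy flats without a common
   edge. *)
have R2 n (WW : {set {set {set 'I_n.+1}}}) : 3 <= n -> WW != set0 ->
    WW \subset parts 'I_n.+1 (#|'I_n.+1| - 2) -> crossing WW -> spread WW ->
    #|WW| <= HM n 2 /\ (#|WW| = HM n 2 -> is_hilton_milner 2 WW).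
  move=> n3; apply: rank2; last exact: card_h.
  - by rewrite card_ord ltnS ltnW.
  - by rewrite HM_rank2.
split=> [n k m k3 -> big A Aint rk0 | n n3].
  have m6 : 6 <= 'C(k.+1, 2) by rewrite (_ : 6 = 'C(4, 2)) // leq_bin2l.
  (* The cubic term of the hypothesis alone gives this, as [m ^ 2 <= m ^ 3]. *)
  have b_large : 'C(k.+1, 2) ^ 3 + 'C(k.+1, 2) ^ 2 <= n.+1 - k.
    apply: leq_trans big; move: 'C(k.+1, 2) m6 => a a6.
    have := double_bin2 a; rewrite !expnS expn0; nia.
  have k_lt : k < n.
    have : 2 <= n.+1 - k.
      apply: leq_trans b_large; apply: leq_trans (leq_addr _ _).
      apply: leq_trans (isT : 2 <= 6) (leq_trans m6 _).
      by rewrite -{1}['C(_, _)]expn1 leq_pexp2l // (leq_trans _ m6).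
    by clear; lia.
  have [A0 Ap Ac] := intersecting_crossing (ltnW k_lt) Aint.
  have As : spread A by case: Aint => _ Af _; apply: bigmeet_spread Af rk0.
  have n3 : 3 <= n by apply: leq_trans k3 (ltnW k_lt).
  have k0 : 0 < k by apply: leq_trans k3.
  have [leA maxA] : #|A| <= HM n k /\ (#|A| = HM n k -> is_hilton_milner k A).
    apply: large_rank => //.
    - by rewrite card_ord; apply: leqW.
    - by rewrite card_ord.
    - exact: card_h.
    (* [HM_bounds] speaks of [n] points and [large_rank] of [n.+1], hence the shift by one. *)
    - by have [_] := HM_bounds k0 k_lt; rewrite card_ord !subSS !subn1 -subn2.
    - by move=> WW WW0 WWp WWc WWs; rewrite -(HM_rank2 n3); case: (R2 n WW).
  by split=> // Y Y01 cY; apply: isomorphic_hilton_milner => //; apply: leq_trans k3.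
split; last exact: HM_rank2.
move=> A Aint rk0; have [A0 Ap Ac] := intersecting_crossing (ltnW n3) Aint.
have As : spread A by case: Aint => _ Af _; apply: bigmeet_spread Af rk0.
have [leA maxA] := R2 n A n3 A0 Ap Ac As.
by split=> // Y Y01 cY; apply: isomorphic_hilton_milner.
Qed.
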